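(* Let $m,n$ be positive integers, let $R=(r_1,\ldots,r_m)$ be a vector of positive integers and $C=(c_1,\ldots,c_n)$ a vector of positive integers such that $\sum_{i=1}^m r_i=\sum_{j=1}^n c_j=N$, $0<r_i<n$ for all $i$ and $0<c_j<m$ for all $j$. Let $\Sigma(R,C)$ be the set of all $m\times n$ matrices $D=(d_{ij})$ with $d_{ij}\in\{0,1\}$, row sums $\sum_{j} d_{ij}=r_i$ ($i=1,\ldots,m$) and column sums $\sum_i d_{ij}=c_j$ ($j=1,\ldots,n$). Define, for $\mathbf{x}=(x_1,\ldots,x_m)$ and $\mathbf{y}=(y_1,\ldots,y_n)$ with positive coordinates, $$F(\mathbf{x},\mathbf{y})=\Big(\prod_{i=1}^m x_i^{-r_i}\Big)\Big(\prod_{j=1}^n y_j^{-c_j}\Big)\prod_{i=1}^m\prod_{j=1}^n(1+x_iy_j),$$ and let $\alpha(R,C)=\inf_{x_1,\ldots,x_m>0,\ y_1,\ldots,y_n>0}F(\mathbf{x},\mathbf{y})$. Then $$\alpha(R,C)\ \ge\ |\Sigma(R,C)|\ \ge\ \frac{(mn)!}{(mn)^{mn}}\Big(\prod_{i=1}^m\frac{(n-r_i)^{n-r_i}}{(n-r_i)!}\Big)\Big(\prod_{j=1}^n\frac{c_j^{c_j}}{c_j!}\Big)\alpha(R,C).$$ *)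

(* Defs.v *)
From mathcomp Require Import all_boot all_order all_algebra.
From mathcomp Require Import mathcomp_extra classical_sets reals.

Set Implicit Arguments.
Unset Strict Implicit.
Unset Printing Implicit Defensive.

Import Order.TTheory GRing.Theory Num.Theory.
Local Open Scope ring_scope.

(* 0/1 matrices are encoded as boolean matrices, bool being coerced to nat in
   the row and column sums. *)
Definition Sigma (m n : nat) (r : 'I_m -> nat) (c : 'I_n -> nat) :
    {set 'M[bool]_(m, n)} :=
  [set D : 'M[bool]_(m, n) |
    [forall i, (\sum_(j < n) D i j == r i)%N] &&
    [forall j, (\sum_(i < m) D i j == c j)%N]].

Definition F (R : realType) (m n : nat) (r : 'I_m -> nat) (c : 'I_n -> nat)
    (x : 'I_m -> R) (y : 'I_n -> R) : R :=
  (\prod_(i < m) x i ^- r i) * (\prod_(j < n) y j ^- c j) *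
  \prod_(i < m) \prod_(j < n) (1 + x i * y j).

(* The set below is nonempty and bounded below by 0, so that the real-valued
   inf is its actual greatest lower bound. *)
Definition alpha (R : realType) (m n : nat) (r : 'I_m -> nat)
    (c : 'I_n -> nat) : R :=
  inf [set a : R | exists (x : 'I_m -> R) (y : 'I_n -> R),
    [/\ forall i, 0 < x i, forall j, 0 < y j & a = F r c x y]]%classic.

(* Main.v *)
Require Import Defs.
From mathcomp Require Import mathcomp_extra classical_sets reals.
From mathcomp Require Import all_boot all_order all_algebra.
From mathcomp Require Import polyrcf complex.
From mathcomp Require Import ring.

Set Implicit Arguments.
Unset Strict Implicit.
Unset Printing Implicit Defensive.

Import Order.TTheory GRing.Theory Num.Theory.
Local Open Scope ring_scope.

(** Expanding the product in [F] and keeping only the matrices of [Sigma] gives the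
upper bound on [#|Sigma r c|].

For the lower bound, put [u_i = 1 / x_i]: then [F] is the quotient of the product of
the [mn] linear forms [u_i + y_j] by the monomial [prod u_i^(n - r_i) prod y_j^c_j],
and [#|Sigma r c|] is the coefficient of this monomial. The coefficients of a product
of [D] linear forms are, up to factorials, permanents [M(a_1^k_1, ..., a_s^k_s)], where
[a_j] is the vector of the coefficients of the [j]-th variable, and the theorem is an
instance of van der Waerden's inequality in Gurvits' capacity form:
some [z > 0] satisfies [M((sum z_j a_j)^D) <= D^D prod (z_j^k_j / k_j^k_j) M(a^k)].

For positive vectors, [M(a_1, ..., a_s, z, ..., z)] does not vanish when all the
coordinates of [z] lie in the upper half-plane (Gauss-Lucas). For two remaining slots
this is Alexandrov's inequality [M(a, b, ..)^2 >= M(a, a, ..) M(b, b, ..)], so that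
[j |-> M(a^j, w^(d - j), ..)] is log-concave; comparing it with a geometric progression
bounds [M((t a + w)^d, ..)] for a suitable [t], which extracts one variable. Iterating
over the variables makes the constants telescope to [D^D / prod k_j^k_j]. *)

(** * Mixed permanents: symmetry, multilinearity and expansions *)

Section Mixed.
Variables (R : comNzRingType) (I : finType).
Implicit Types (u v a b : {ffun I -> R}) (vs ws us : seq {ffun I -> R}).
Implicit Types (S T : {set I}).

Definition lcomb (t : R) a b : {ffun I -> R} := [ffun i => t * a i + b i].

(* The permanent of the matrix with rows indexed by [S] and columns [vs], when
   [size vs = #|S|]. *)
Fixpoint mixed vs S : R :=
  if vs is v :: vs' then \sum_(i in S) v i * mixed vs' (S :\ i) else 1.

Lemma mixed_swap u v vs S : mixed (u :: v :: vs) S = mixed (v :: u :: vs) S.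
Proof.
rewrite /=.
under eq_bigr do rewrite big_distrr.
under [RHS]eq_bigr do rewrite big_distrr.
rewrite (exchange_big_dep (mem S)) /=; last by move=> i j _ /setD1P[].
apply: eq_bigr => j jS; apply: eq_big => i; first by rewrite !inE jS andbT eq_sym andbC.
by move=> _; rewrite mulrCA setDDl setUC -setDDl.
Qed.

(** The recursion in [mixed] exposes only the head of the list, so symmetries of a tail are carried
    under a prefix this way. *)
Lemma eq_mixed_cat ws us vs : (forall S, mixed us S = mixed vs S) ->
  forall S, mixed (ws ++ us) S = mixed (ws ++ vs) S.
Proof.
move=> e; elim: ws => [|w ws IH] S //=.
by apply: eq_bigr => i _; rewrite IH.
Qed.

Lemma mixed_shift u ws vs S : mixed (u :: ws ++ vs) S = mixed (ws ++ u :: vs) S.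
Proof.
elim: ws S => [|w ws IH] S //.
rewrite !cat_cons mixed_swap.
exact: (eq_mixed_cat [:: w] IH).
Qed.

Lemma mixed_catCA us ws vs S : mixed (us ++ ws ++ vs) S = mixed (ws ++ us ++ vs) S.
Proof.
elim: us ws vs S => [|u us IH] ws vs S //.
rewrite cat_cons mixed_shift.
rewrite -[LHS](_ : mixed (us ++ ws ++ u :: vs) S = _); last first.
  by apply: eq_mixed_cat => T; rewrite mixed_shift.
by rewrite IH; apply: eq_mixed_cat => T; rewrite -mixed_shift.
Qed.

Lemma mixed_linear t a b vs S :
  mixed (lcomb t a b :: vs) S = t * mixed (a :: vs) S + mixed (b :: vs) S.
Proof.
rewrite /= big_distrr -big_split; apply: eq_bigr => i _ /=.
by rewrite !ffunE /= mulrDl mulrA.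
Qed.

(** Multilinearity and symmetry give a binomial theorem; the two sums of the inductive step
    recombine by Pascal's rule. *)
Lemma mixed_binom d t a b vs S :
  mixed (nseq d (lcomb t a b) ++ vs) S =
  \sum_(k < d.+1) t ^+ k * mixed (nseq k a ++ nseq (d - k) b ++ vs) S *+ 'C(d, k).
Proof.
elim: d vs S => [|d IH] vs S; first by rewrite big_ord1 expr0 mul1r.
rewrite [nseq d.+1 _]/= cat_cons mixed_linear !mixed_shift !IH.
rewrite [X in _ + X]big_ord_recl [in RHS]big_ord_recl /=.
rewrite !bin0 !subn0 !expr0 !mul1r !mulr1n -mixed_shift addrCA; congr (_ + _).
under [in RHS]eq_bigr => k _ do rewrite /bump add1n subSS binS mulrnDr.
rewrite big_split /= addrC; congr (_ + _).
  rewrite [in RHS]big_ord_recr /= bin_small // mulr0n addr0.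
  apply: eq_bigr => k _; rewrite /bump add1n; congr (_ * _ *+ _).
  apply: (eq_mixed_cat (_ :: _)) => T.
  by rewrite -mixed_shift -cat_cons -[b :: _]/(nseq (d - k.+1).+1 b) -subSn ?subSS.
rewrite big_distrr /=; apply: eq_bigr => k _.
rewrite mulrnAr exprS -mulrA; congr (_ * (_ * _) *+ _).
rewrite [RHS]mixed_shift; apply: eq_mixed_cat => T.
by rewrite mixed_shift.
Qed.

(** Laplace expansion along [k] equal columns: [T] is the set of rows they use, and the factorial
    counts the ways to distribute these rows among the copies. *)
Lemma mixed_nseq k a vs S :
  mixed (nseq k a ++ vs) S =
  k`!%:R * \sum_(T : {set I} | (T \subset S) && (#|T| == k))
             (\prod_(i in T) a i) * mixed vs (S :\: T).
Proof.
elim: k S => [|k IH] S.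
  rewrite fact0 mul1r (big_pred1 set0) ?big_set0 ?setD0 ?mul1r // => T /=.
  by rewrite cards_eq0; case: eqP => [->|]; rewrite ?sub0set ?andbF.
rewrite /= factS natrM.
under eq_bigr => i iS do rewrite IH mulrCA.
rewrite -big_distrr /= mulrAC mulrC; congr (_ * _).
under eq_bigr do rewrite big_distrr /=.
(* A first row [i] together with a set avoiding it becomes a set [T] with a marked element, so each
   [T] is counted [k.+1] times. *)
have addT i : i \in S ->
   \sum_(T : {set I} | (T \subset S :\ i) && (#|T| == k))
      a i * ((\prod_(j in T) a j) * mixed vs (S :\ i :\: T)) =
   \sum_(T : {set I} | [&& T \subset S, #|T| == k.+1 & i \in T])
      (\prod_(j in T) a j) * mixed vs (S :\: T).
  move=> iS; rewrite [RHS](reindex_onto (fun T => i |: T) (fun T => T :\ i)) /=; last first.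
    by move=> T /and3P[_ _ iT]; rewrite setD1K.
  apply: eq_big => T.
    rewrite subsetD1 setU11 andbT subUset sub1set iS /=.
    case: (boolP (i \in T)) => iT /=.
      rewrite andbF; apply/esym/negP => /andP[_ /eqP e].
      by move: iT; rewrite -e !inE eqxx.
    by rewrite andbT cardsU1 iT setU1K // eqxx andbT.
  rewrite subsetD1 => /andP[/andP[_ iT] _].
  by rewrite big_setU1 //= mulrA setDDl.
rewrite (eq_bigr _ addT).
rewrite (exchange_big_dep (fun T : {set I} => (T \subset S) && (#|T| == k.+1))) /=;
  last first.
  by move=> i T iS /and3P[-> ->].
rewrite mulrC big_distrl /=; apply: eq_bigr => T /andP[TS /eqP cT].
rewrite (eq_bigl (mem T)); last first.
  by move=> i /=; rewrite TS cT eqxx /= andb_idl // => /(subsetP TS).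
by rewrite sumr_const cT mulr_natr.
Qed.

Lemma mixed_nseq_card S a : mixed (nseq #|S| a) S = (#|S|)`!%:R * \prod_(i in S) a i.
Proof.
rewrite -[nseq _ _]cats0 mixed_nseq; congr *%R.
rewrite (big_pred1 S) /= ?mulr1 // => T.
apply/andP/eqP => [[TS /eqP e]|->]; last by rewrite subxx.
by apply/eqP; rewrite eqEcard TS e leqnn.
Qed.
End Mixed.

Lemma mixed_rmorph (R R' : comNzRingType) (f : {rmorphism R -> R'}) (I : finType)
    (vs : seq {ffun I -> R}) S :
  f (mixed vs S) = mixed [seq [ffun i => f (v i)] | v : {ffun I -> R} <- vs] S.
Proof.
elim: vs S => [|v vs IH] S /=; first exact: rmorph1.
by rewrite rmorph_sum; apply: eq_bigr => i _; rewrite rmorphM IH ffunE.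
Qed.

Lemma mixed_gt0 (R : numDomainType) (I : finType) (vs : seq {ffun I -> R}) (S : {set I}) :
  (forall v, v \in vs -> forall i, 0 < v i) -> (size vs <= #|S|)%N -> 0 < mixed vs S.
Proof.
elim: vs S => [|v vs IH] S vs_gt0 szS /=; first exact: ltr01.
have term_gt0 i : i \in S -> 0 < v i * mixed vs (S :\ i).
  move=> iS; rewrite mulr_gt0 ?vs_gt0 ?mem_head //; apply: IH.
    by move=> w wvs; apply: vs_gt0; rewrite inE wvs orbT.
  by move: szS; rewrite (cardsD1 i) iS.
have [i iS] : exists i, i \in S by apply/card_gt0P; apply: leq_trans szS.
rewrite (bigD1 i) //=; apply: ltr_pwDl; first exact: term_gt0.
by apply: sumr_ge0 => j /andP[jS _]; apply/ltW/term_gt0.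
Qed.

(** * Stability in the upper half-plane, Alexandrov's inequality and log-concavity *)

Section Stability.
Variables (C : numClosedFieldType).

(* The ratio of the two lowest coefficients is minus the sum of the inverses of
   the roots, which lies in the open lower half-plane. *)
Lemma coef1_neq0_of_roots (p : {poly C}) :
  (1 < size p)%N -> (forall t, root p t -> 'Im t < 0) -> p`_1 != 0.
Proof.
have [rs Hp] := closed_field_poly_normal p => sp roots_p.
have p0 : p != 0 by rewrite -size_poly_eq0 -lt0n; apply: ltnW.
(* The weak sign covers the empty product, whose ratio is 0; each factor ['X - z%:P] adds [- z^-1]
   to the ratio, with negative imaginary part. *)
have key (s : seq C) : (forall t, t \in s -> 'Im t < 0) ->
    let q := \prod_(z <- s) ('X - z%:P) in
    [/\ q`_0 != 0, 'Im (q`_1 / q`_0) <= 0 & s != [::] -> 'Im (q`_1 / q`_0) < 0].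
  elim: s => [_|z s IH im_s] /=.
    by rewrite big_nil !coef1 /= mul0r raddf0 oner_neq0 lexx.
  rewrite big_cons; set q := \prod_(_ <- _) _.
  have [|q0 im_q _] := IH; first by move=> t ts; apply: im_s; rewrite inE ts orbT.
  have im_z : 'Im z < 0 by apply: im_s; rewrite mem_head.
  have z0 : z != 0 by apply: contraTneq im_z => ->; rewrite raddf0 ltxx.
  rewrite mulrBl !coefB !coefXM !coefCM /= sub0r.
  have -> : (q`_0 - z * q`_1) / - (z * q`_0) = q`_1 / q`_0 - z^-1.
    by field; rewrite z0 q0.
  have lt0 : 'Im (q`_1 / q`_0 - z^-1) < 0.
    rewrite raddfB /= ImV mulNr opprK -[ltRHS]addr0; apply: ler_ltD => //.
    by rewrite ltr_pdivrMr ?mul0r // exprn_gt0 // normr_gt0.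
  by split; [rewrite oppr_eq0 mulf_neq0 | apply: ltW | ].
have rs_im t : t \in rs -> 'Im t < 0.
  move=> trs; apply: roots_p; rewrite Hp rootZ ?lead_coef_eq0 //.
  by rewrite root_prod_XsubC.
have [q0 _ lt0] := key rs rs_im.
have rs0 : rs != [::].
  apply: contraTneq sp => e; rewrite Hp e big_nil size_scale ?lead_coef_eq0 //.
  by rewrite size_poly1.
rewrite Hp coefZ mulf_neq0 ?lead_coef_eq0 //.
by apply: contraTneq (lt0 rs0) => ->; rewrite mul0r raddf0 ltxx.
Qed.

Variable (I : finType).

(* Gauss-Lucas: removing one copy of [z] in favour of a positive vector is a
   directional derivative, which preserves non-vanishing on the upper half-plane. *)
Lemma mixed_stable (pre : seq {ffun I -> C}) d (z : {ffun I -> C}) (S : {set I}) :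
  (forall v, v \in pre -> forall i, 0 < v i) -> (forall i, 0 < 'Im (z i)) ->
  (d + size pre)%N = #|S| -> mixed (nseq d z ++ pre) S != 0.
Proof.
elim: pre d z => [|a pre IH] d z pre_gt0 im_z szS.
  rewrite cats0 -[d]addn0 szS mixed_nseq_card mulf_neq0 //.
    by rewrite pnatr_eq0 -lt0n fact_gt0.
  apply/prodf_neq0 => i _; apply: contraTneq (im_z i) => ->.
  by rewrite raddf0 ltxx.
have a_gt0 i : 0 < a i by apply: pre_gt0; rewrite mem_head.
have pre'_gt0 v : v \in pre -> forall i, 0 < v i.
  by move=> vp; apply: pre_gt0; rewrite inE vp orbT.
(* [p] is the permanent with [d.+1] copies of [t a + z]. For [0 <= 'Im t] this vector stays in the
   upper half-plane, so the induction hypothesis confines the roots of [p] to ['Im t < 0]. Its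
   coefficient of degree 1 is [d.+1] times the permanent of the goal. *)
pose c k := mixed (nseq k a ++ nseq (d.+1 - k) z ++ pre) S *+ 'C(d.+1, k).
pose p := \poly_(k < d.+2) c k.
have pE t : p.[t] = mixed (nseq d.+1 (lcomb t a z) ++ pre) S.
  rewrite mixed_binom horner_poly; apply: eq_bigr => k _.
  by rewrite /c mulrC mulrnAr.
have p1 : p`_1 != 0.
  apply: coef1_neq0_of_roots => [|t].
    rewrite size_poly_eq // /c subnn binn mulr1n lt0r_neq0 //.
    apply: mixed_gt0 => [v|]; last by rewrite size_cat size_nseq -szS addSnnS.
    by rewrite mem_cat => /orP[/nseqP[-> _]|/pre'_gt0].
  rewrite rootE pE; apply: contraTT; rewrite -real_leNgt ?real0 ?Creal_Im // => im_t.
  apply: IH => //; last by rewrite -szS addSnnS.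
  move=> i; rewrite ffunE raddfD /= ImMr ?gtr0_real //.
  by apply: ltr_wpDl => //; rewrite mulr_ge0 // ltW.
move: p1; rewrite coef_poly /= /c subn1 /= bin1 mulrn_eq0 /=.
by rewrite -mixed_shift.
Qed.
End Stability.

(** Were it false, the quadratic [A t^2 + 2 B t + D], the permanent with two copies of [t a + b],
    would have a root in the open upper half-plane, against [mixed_stable]. *)
Lemma mixed_alexandrov (R : rcfType) (I : finType) (a b : {ffun I -> R})
    (pre : seq {ffun I -> R}) (S : {set I}) :
  (forall i, 0 < a i) -> (forall i, 0 < b i) ->
  (forall v, v \in pre -> forall i, 0 < v i) -> (size pre).+2 = #|S| ->
  mixed (a :: a :: pre) S * mixed (b :: b :: pre) S <= mixed (a :: b :: pre) S ^+ 2.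
Proof.
move=> a_gt0 b_gt0 pre_gt0 szS.
set A := mixed (a :: a :: pre) S; set B := mixed (a :: b :: pre) S.
set D := mixed (b :: b :: pre) S.
have A_gt0 : 0 < A.
  apply: mixed_gt0 => [v|]; last by rewrite -szS.
  by rewrite !inE => /or3P[/eqP->|/eqP->|/pre_gt0].
rewrite leNgt; apply/negP => lt_disc.
pose f : {rmorphism R -> R[i]} := real_complex R.
have f_real x : f x \is Num.real by rewrite realE -(rmorph0 f) !lecR -realE num_real.
pose c (v : {ffun I -> R}) : {ffun I -> R[i]} := [ffun i => f (v i)].
pose s := Num.sqrt (A * D - B ^+ 2).
have s_gt0 : 0 < s by rewrite sqrtr_gt0 subr_gt0.
have s2 : s ^+ 2 = A * D - B ^+ 2 by rewrite sqr_sqrtr // subr_ge0 ltW.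
pose t : R[i] := (f (- B) + 'i * f s) * f A^-1.
have im_t : 0 < 'Im t.
  rewrite ImMr // Im_rect // -rmorphM -(rmorph0 f) ltcR.
  by rewrite mulr_gt0 ?invr_gt0.
have /negP[] : mixed (nseq 2 (lcomb t (c a) (c b)) ++ map c pre) S != 0.
  apply: mixed_stable => [v|i|]; last by rewrite size_map.
    by move=> /mapP[w wp ->] i; rewrite ffunE -(rmorph0 f) ltcR pre_gt0.
  rewrite !ffunE raddfD /= ImMr ?f_real // [X in _ + X](Creal_ImP _ (f_real (b i))) addr0.
  by rewrite mulr_gt0 // -(rmorph0 f) ltcR.
have cE v w : mixed [:: c v, c w & map c pre] S = f (mixed [:: v, w & pre] S).
  by rewrite mixed_rmorph.
have fA : f A != 0 by rewrite fmorph_eq0 lt0r_neq0.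
rewrite [nseq _ _ ++ _]/= mixed_linear mixed_swap mixed_linear.
rewrite [X in _ + X]mixed_swap mixed_linear [mixed [:: c b, c a & _] _]mixed_swap !cE.
rewrite -/A -/B -/D.
have tA : t * f A = f (- B) + 'i * f s.
  by rewrite -mulrA -rmorphM mulVf ?lt0r_neq0 // rmorph1 mulr1.
(* Multiplying by [A] completes the square: the quadratic becomes [(A t + B)^2 - (B^2 - A D)]. *)
rewrite -(mulrI_eq0 _ (lregP fA)).
have -> : f A * (t * (t * f A + f B) + (t * f B + f D)) =
    (t * f A + f B) ^+ 2 - (f B ^+ 2 - f A * f D) by ring.
rewrite tA rmorphN addrAC addNr add0r exprMn sqrCi.
have -> : f s ^+ 2 = f A * f D - f B ^+ 2.
  by rewrite -rmorphXn s2 rmorphB rmorphM rmorphXn.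
by apply/eqP; ring.
Qed.

(** The ratios [b j.+1 / b j] are nonincreasing, so [b] lies below the geometric progression through
    [b k] with ratio [b k.+1 / b k]. Both sides carry a power of this ratio to keep the exponents
    natural when [j < k]. *)
Lemma log_concave_bound (R : realFieldType) (b : nat -> R) d k :
  (forall j, (j <= d)%N -> 0 < b j) ->
  (forall j, (j.+2 <= d)%N -> b j * b j.+2 <= b j.+1 ^+ 2) -> (k < d)%N ->
  forall j, (j <= d)%N -> b j * (b k.+1 / b k) ^+ k <= b k * (b k.+1 / b k) ^+ j.
Proof.
move=> b_gt0 b_lc kd; pose q j := b j.+1 / b j; rewrite -/(q k).
have q_gt0 j : (j < d)%N -> 0 < q j.
  by move=> jd; rewrite divr_gt0 ?b_gt0 // ltnW.
have qE j : (j < d)%N -> b j.+1 = q j * b j.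
  by move=> jd; rewrite divfK // lt0r_neq0 // b_gt0 // ltnW.
have q_mono i e : (i + e < d)%N -> q (i + e)%N <= q i.
  elim: e => [|e IH]; rewrite ?addn0 // addnS => ied.
  apply: le_trans (IH (ltnW ied)).
  have b1 : 0 < b (i + e).+1 by rewrite b_gt0 // ltnW.
  have b0 : 0 < b (i + e)%N by rewrite b_gt0 // ltnW // ltnW.
  rewrite ler_pdivrMr // mulrAC ler_pdivlMr //.
  by rewrite mulrC -expr2 b_lc.
have up e : (k + e <= d)%N -> b (k + e)%N <= b k * q k ^+ e.
  elim: e => [|e IH]; rewrite ?addn0 ?expr0 ?mulr1 // addnS => ked.
  rewrite qE // exprSr mulrA mulrC; apply: ler_pM.
  - by rewrite ltW // b_gt0 // ltnW.
  - by rewrite ltW // q_gt0.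
  - exact: IH (ltnW ked).
  - exact: q_mono.
have down j e : (j + e <= k)%N -> b j * q k ^+ e <= b (j + e)%N.
  elim: e => [|e IH]; rewrite ?addn0 ?expr0 ?mulr1 // addnS => jek.
  have jed : (j + e < d)%N by apply: leq_ltn_trans kd; apply: ltnW.
  rewrite qE // exprSr mulrA mulrC; apply: ler_pM.
  - by rewrite ltW // q_gt0.
  - rewrite mulr_ge0 ?exprn_ge0 ?(ltW (q_gt0 _ _)) // ltW // b_gt0 //.
    rewrite (leq_trans _ (ltnW jed)) //.
    exact: leq_addr.
  - by rewrite -{1}(subnKC (ltnW jek)) q_mono // subnKC // ltnW.
  - exact: IH (ltnW jek).
move=> j jd; have [kj|/ltnW jk] := leqP k j.
  rewrite -(subnKC kj) exprD mulrCA mulrC ler_wpM2l ?exprn_ge0 ?(ltW (q_gt0 _ _)) //.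
  by apply: up; rewrite subnKC.
rewrite -{2}(subnKC jk) addnC exprD mulrA ler_wpM2r ?exprn_ge0 ?(ltW (q_gt0 _ _)) //.
by have := down j (k - j)%N; rewrite subnKC //; apply.
Qed.

(** * The capacity inequality for positive vectors, one variable at a time *)

Section Capacity.
Variables (R : rcfType) (I : finType).
Implicit Types (a w : {ffun I -> R}) (pre : seq {ffun I -> R}) (S : {set I}).

Lemma mixed_capacity_step k l a w pre S :
  (0 < k)%N -> (0 < l)%N -> (forall i, 0 < a i) -> (forall i, 0 < w i) ->
  (forall v, v \in pre -> forall i, 0 < v i) -> (k + l + size pre)%N = #|S| ->
  exists2 t, 0 < t &
    mixed (nseq (k + l) (lcomb t a w) ++ pre) S <=
    t ^+ k * ((k + l)%:R ^+ (k + l) / (k%:R ^+ k * l%:R ^+ l)) *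
    mixed (nseq k a ++ nseq l w ++ pre) S.
Proof.
move=> k_gt0 l_gt0 a_gt0 w_gt0 pre_gt0 szS; set d := (k + l)%N.
pose b j := mixed (nseq j a ++ nseq (d - j) w ++ pre) S.
have mem_gt0 i j v : v \in nseq i a ++ nseq j w ++ pre -> forall i, 0 < v i.
  by rewrite !mem_cat => /or3P[/nseqP[-> _]|/nseqP[-> _]|/pre_gt0].
have b_gt0 j : (j <= d)%N -> 0 < b j.
  move=> jd; apply: mixed_gt0; first exact: mem_gt0.
  by rewrite !size_cat !size_nseq addnA subnKC // szS.
have b_lc j : (j.+2 <= d)%N -> b j * b j.+2 <= b j.+1 ^+ 2.
  move=> jd; pose pre' := nseq j a ++ nseq (d - j.+2) w ++ pre.
  have dj1 : (d - j.+1 = (d - j.+2).+1)%N by rewrite -subSn ?subSS.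
  have dj0 : (d - j = (d - j.+2).+2)%N by rewrite -dj1 -subSn ?subSS // ltnW.
  have -> : b j.+2 = mixed [:: a, a & pre'] S by [].
  have -> : b j.+1 = mixed [:: a, w & pre'] S.
    rewrite /b dj1; apply: (eq_mixed_cat [:: a]) => T.
    by rewrite [RHS]mixed_shift.
  have -> : b j = mixed [:: w, w & pre'] S.
    rewrite /b dj0 -[RHS](eq_mixed_cat [:: w] (fun T => esym (mixed_shift _ _ _ T))).
    by rewrite [RHS]mixed_shift.
  rewrite mulrC; apply: mixed_alexandrov => //; first exact: mem_gt0.
  by rewrite !size_cat !size_nseq addnA -!addSn subnKC.
have kd : (k < d)%N by rewrite -addn1 leq_add2l.
have [s s_gt0 bound] : exists2 s, 0 < s &
    forall j, (j <= d)%N -> b j * s ^+ k <= b k * s ^+ j.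
  exists (b k.+1 / b k); last exact: log_concave_bound.
  by rewrite divr_gt0 ?b_gt0 // ltnW.
have k0 : (k%:R : R) != 0 by rewrite pnatr_eq0 -lt0n.
have l0 : (l%:R : R) != 0 by rewrite pnatr_eq0 -lt0n.
have s0 : s != 0 by rewrite lt0r_neq0.
(* This [t] minimises [(1 + s t)^d / (s t)^k], the minimum being at [s t = k / l]; its value is
   exactly [d^d / (k^k l^l)]. *)
have [t t_gt0 tE] : exists2 t, 0 < t & t = k%:R / (s * l%:R).
  by exists (k%:R / (s * l%:R)) => //; rewrite divr_gt0 ?ltr0n // mulr_gt0 ?ltr0n.
exists t => //.
have bkE : mixed (nseq k a ++ nseq l w ++ pre) S = b k by rewrite /b /d addKn.
rewrite mixed_binom bkE.
have le_sum : \sum_(j < d.+1) t ^+ j * b j *+ 'C(d, j) <=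
              \sum_(j < d.+1) b k / s ^+ k * (1 ^+ (d - j) * (s * t) ^+ j *+ 'C(d, j)).
  apply: ler_sum => j _; rewrite [leRHS]mulrnAr lerMn2r; apply/orP; right.
  rewrite expr1n mul1r exprMn mulrA [leRHS]mulrC ler_pM2l ?exprn_gt0 //.
  rewrite mulrAC ler_pdivlMr ?exprn_gt0 //.
  by apply: bound; rewrite -ltnS.
apply: le_trans le_sum _.
rewrite -big_distrr /= -exprDn.
have -> : 1 + s * t = d%:R / l%:R.
  by rewrite tE /d natrD; field; rewrite s0 l0.
rewrite le_eqVlt; apply/orP; left; apply/eqP; rewrite tE !expr_div_n exprMn [l%:R ^+ d]exprD.
by field; rewrite ?expf_neq0.
Qed.

Definition wsum (J : finType) (s : seq J) (z : J -> R) (a : J -> {ffun I -> R}) :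
    {ffun I -> R} :=
  [ffun i => \sum_(j <- s) z j * a j i].

(** Induction on [s] by [mixed_capacity_step], with [w] the weighted sum of the remaining vectors:
    their factor [e^e] cancels the one in the denominator of the step. *)
Lemma mixed_capacity (J : finType) (a : J -> {ffun I -> R}) (k : J -> nat) (s : seq J) pre S :
  uniq s -> s != [::] -> (forall j, 0 < k j)%N -> (forall j i, 0 < a j i) ->
  (forall v, v \in pre -> forall i, 0 < v i) ->
  (\sum_(j <- s) k j + size pre)%N = #|S| ->
  exists2 z : J -> R, (forall j, 0 < z j) &
    mixed (nseq (\sum_(j <- s) k j) (wsum s z a) ++ pre) S <=
    (\prod_(j <- s) (z j ^+ k j / (k j)%:R ^+ k j)) *
    (\sum_(j <- s) k j)%:R ^+ (\sum_(j <- s) k j) *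
    mixed (flatten [seq nseq (k j) (a j) | j <- s] ++ pre) S.
Proof.
move=> + + k_gt0 a_gt0; elim: s pre => [|j s IH] pre //= /andP[js us] _ pre_gt0 szS.
have [s0|s0] := eqVneq s [::].
  exists (fun=> 1) => //; rewrite s0 !big_seq1 /= cats0.
  have -> : wsum [:: j] (fun=> 1) a = a j.
    by apply/ffunP => i; rewrite ffunE big_seq1 mul1r.
  by rewrite expr1n divfK ?mul1r // expf_neq0 // pnatr_eq0 -lt0n.
rewrite big_cons in szS *; set e := (\sum_(i <- s) k i)%N in szS *.
have e_gt0 : (0 < e)%N.
  by rewrite /e; case: (s) s0 => // j' s' _; rewrite big_cons addn_gt0 k_gt0.
(* The copies of [a j] join [pre], so that [z] suits the permanent left over by the step that splits
   off [j]. *)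
have [||z z_gt0 Hz] := IH (nseq (k j) (a j) ++ pre) us s0.
- by move=> v; rewrite mem_cat => /orP[/nseqP[-> _]|/pre_gt0].
- by rewrite size_cat size_nseq addnCA addnA.
have w_gt0 i : 0 < wsum s z a i.
  rewrite ffunE; case: (s) s0 => // j' s' _; rewrite big_cons.
  apply: ltr_pwDl; first exact: mulr_gt0.
  by apply: sumr_ge0 => j'' _; rewrite ltW // mulr_gt0.
have [t t_gt0 Ht] := mixed_capacity_step (k_gt0 j) e_gt0 (a_gt0 j) w_gt0 pre_gt0 szS.
pose z' i := if i == j then t else z i.
have z'E i : i \in s -> z' i = z i.
  by rewrite /z'; case: eqP => // -> /(negP js).
exists z'; first by move=> i; rewrite /z'; case: ifP.
have -> : wsum (j :: s) z' a = lcomb t (a j) (wsum s z a).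
  apply/ffunP => i; rewrite !ffunE big_cons /z' eqxx; congr (_ + _).
  by apply: eq_big_seq => i' /z'E; rewrite /z' => ->.
rewrite big_cons {1 2}/z' eqxx.
have -> : \prod_(i <- s) (z' i ^+ k i / (k i)%:R ^+ k i) =
          \prod_(i <- s) (z i ^+ k i / (k i)%:R ^+ k i).
  by apply: eq_big_seq => i' /z'E ->.
apply: le_trans Ht _.
rewrite mixed_catCA.
have e0 : (e%:R : R) != 0 by rewrite pnatr_eq0 -lt0n.
have k0 : ((k j)%:R : R) != 0 by rewrite pnatr_eq0 -lt0n.
have c_ge0 : 0 <= t ^+ k j * ((k j + e)%:R ^+ (k j + e) / ((k j)%:R ^+ k j * e%:R ^+ e)).
  by rewrite mulr_ge0 ?exprn_ge0 ?(ltW t_gt0) // divr_ge0 // ?mulr_ge0 ?exprn_ge0 ?ler0n.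
apply: le_trans (ler_wpM2l c_ge0 Hz) _.
rewrite mixed_catCA -catA.
by rewrite le_eqVlt; apply/orP; left; apply/eqP; field; rewrite ?expf_neq0.
Qed.
End Capacity.

(** * Permanents as sums over maps with prescribed fibers *)

Section Fibers.
Variables (I J : finType) (k : J -> nat) (j0 : J).
Implicit Types (s : seq J) (S T : {set I}) (phi : {ffun I -> J}).

(* Maps from [S] to [s] with prescribed fiber sizes; they are made total by the
   value [j0] outside [S]. *)
Definition fibered s S phi :=
  [forall i, if i \in S then phi i \in s else phi i == j0] &&
  all (fun j => #|[set i in S | phi i == j]| == k j) s.

(** Redefining a map to be [j] on [T] matches the maps on [S :\: T] with the maps on [S] whose fiber
    over [j] is [T]; the last conjunct is the retraction condition that [reindex_onto] asks for. *)
Lemma fibered_cons j s S T phi : j \notin s -> T \subset S -> #|T| = k j ->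
  let phi1 := [ffun i => if i \in T then j else phi i] in
  [&& fibered (j :: s) S phi1, [set i in S | phi1 i == j] == T
    & [ffun i => if i \in T then j0 else phi1 i] == phi] =
  fibered s (S :\: T) phi.
Proof.
move=> js TS cT phi1.
have fib j' : j' \in s -> [set i in S | phi1 i == j'] = [set i in S :\: T | phi i == j'].
  move=> j's; apply/setP => i; rewrite !inE ffunE; case: (boolP (i \in T)) => //= iT.
  by case: eqP => [e|_]; rewrite ?andbF //; move: js; rewrite e j's.
apply/idP/idP.
  case/and3P => /andP[/forallP ran /andP[_ /allP cnt]] /eqP fj /eqP/ffunP out.
  apply/andP; split.
    apply/forallP => i; rewrite !inE; have := ran i; have := out i.
    have := congr1 (fun A : {set I} => i \in A) fj; rewrite !inE !ffunE.
    case: (boolP (i \in T)) => iT /=; first by move=> _ <-.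
    by case: (i \in S) => //= ->.
  by apply/allP => j' j's; rewrite -fib // cnt.
case/andP => /forallP ran /allP cnt; apply/and3P.
have fj : [set i in S | phi1 i == j] = T.
  apply/setP => i; rewrite !inE ffunE; have := ran i; rewrite !inE.
  case: (boolP (i \in T)) => iT /=; first by rewrite eqxx (subsetP TS).
  by case: (i \in S) => //= ps; apply: contraNF js => /eqP <-.
split; last 2 first.
- exact/eqP.
- apply/eqP/ffunP => i; rewrite !ffunE; have := ran i; rewrite !inE.
  by case: (boolP (i \in T)) => //= iT /eqP.
apply/andP; split.
  apply/forallP => i; rewrite ffunE; have := ran i; rewrite !inE.
  case: (boolP (i \in T)) => /= iT; first by rewrite (subsetP TS _ iT) eqxx.
  by case: (i \in S) => // ->; rewrite orbT.
rewrite /= fj cT eqxx /=; apply/allP => j' j's.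
by rewrite fib // cnt.
Qed.

(** By [mixed_nseq], each block of equal vectors chooses the fiber over its index. *)
Lemma mixed_flatten (R : comNzRingType) (a : J -> {ffun I -> R}) s S :
  uniq s -> (\sum_(j <- s) k j)%N = #|S| ->
  mixed (flatten [seq nseq (k j) (a j) | j <- s]) S =
  (\prod_(j <- s) (k j)`!%:R) *
  \sum_(phi : {ffun I -> J} | fibered s S phi) \prod_(i in S) a (phi i) i.
Proof.
elim: s S => [|j s IH] S.
  rewrite !big_nil => _ /esym/eqP; rewrite cards_eq0 => /eqP ->; rewrite mul1r /=.
  rewrite (big_pred1 [ffun=> j0]) ?big_set0 // => phi.
  rewrite /fibered andbT /=; apply/forallP/eqP => [e|-> i]; last by rewrite inE ffunE.
  by apply/ffunP => i; have := e i; rewrite inE ffunE => /eqP.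
rewrite /= !big_cons => /andP[js us] szS; rewrite mixed_nseq -mulrA; congr (_ * _).
rewrite (partition_big (fun phi : {ffun I -> J} => [set i in S | phi i == j])
           (fun T : {set I} => (T \subset S) && (#|T| == k j))) /=; last first.
  move=> phi /andP[_ /andP[-> _]]; rewrite andbT.
  by apply/subsetP => i; rewrite inE => /andP[].
rewrite big_distrr /=; apply: eq_bigr => T /andP[TS /eqP cT].
rewrite IH //; last by rewrite cardsDS // -szS cT addKn.
rewrite mulrCA; congr (_ * _); rewrite big_distrr /=.
rewrite [RHS](reindex_onto
    (fun phi : {ffun I -> J} => [ffun i => if i \in T then j else phi i])
    (fun phi : {ffun I -> J} => [ffun i => if i \in T then j0 else phi i])) /=; last first.
  move=> phi /andP[_ /eqP fj]; apply/ffunP => i; rewrite !ffunE.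
  by case: ifP => [|->//]; rewrite -fj inE => /andP[_ /eqP ->].
apply: eq_big => phi; first by rewrite -andbA fibered_cons.
move=> _; rewrite [RHS](big_setID T) /= (setIidPr TS); congr (_ * _).
  by apply: eq_bigr => i iT; rewrite ffunE iT.
by apply: eq_bigr => i; rewrite inE => /andP[/negPf iT _]; rewrite ffunE iT.
Qed.
End Fibers.

(** * Passage from positive to nonnegative vectors *)

Lemma poly_limit0_le (R : rcfType) (p : {poly R}) c :
  (forall e, 0 < e -> c <= p.[e]) -> c <= p.[0].
Proof.
move=> cp; rewrite leNgt; apply/negP; rewrite -subr_gt0 => /(poly_cont 0 p)[d d_gt0 near0].
have d2_gt0 : 0 < d / 2 by rewrite divr_gt0.
have := near0 (d / 2); rewrite subr0 gtr0_norm // ltr_pdivrMr // ltr_pMr // ltr1n.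
move=> /(_ isT); rewrite ltr_norml => /andP[_]; rewrite ltrD2r.
by rewrite ltNge cp.
Qed.

(* [mixed_capacity] needs positive vectors; the general case follows by adding
   [e] to all the entries and letting [e] tend to [0]. *)
Lemma capacity_bound (R : rcfType) (I J : finType) (a : J -> {ffun I -> R})
    (k : J -> nat) (cap : R) :
  (0 < #|J|)%N -> (forall j, 0 < k j)%N -> (forall j i, 0 <= a j i) ->
  (\sum_j k j)%N = #|I| ->
  (forall z : J -> R, (forall j, 0 < z j) ->
     cap * \prod_j z j ^+ k j <= \prod_i \sum_j z j * a j i) ->
  cap * (#|I|)`!%:R * \prod_j (k j)%:R ^+ k j <=
  #|I|%:R ^+ #|I| * mixed (flatten [seq nseq (k j) (a j) | j <- index_enum J]) [set: I].
Proof.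
move=> J_gt0 k_gt0 a_ge0 szI capP.
(* ['X] stands for the perturbation [e]: the perturbed permanent is a polynomial in it, hence
   continuous at 0. *)
pose ap j : {ffun I -> {poly R}} := [ffun i => (a j i)%:P + 'X].
pose q := mixed (flatten [seq nseq (k j) (ap j) | j <- index_enum J]) [set: I].
pose ae e j : {ffun I -> R} := [ffun i => a j i + e].
have qE e : q.[e] = mixed (flatten [seq nseq (k j) (ae e j) | j <- index_enum J]) [set: I].
  rewrite -horner_evalE mixed_rmorph map_flatten -map_comp; congr (mixed (flatten _) _).
  apply: eq_map => j /=; rewrite map_nseq; congr nseq; apply/ffunP => i.
  by rewrite !ffunE /= horner_evalE !hornerE.
have ae0 : ae 0 =1 a by move=> j; apply/ffunP => i; rewrite ffunE addr0.
have <- : q.[0] = mixed (flatten [seq nseq (k j) (a j) | j <- index_enum J]) [set: I].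
  by rewrite qE; congr (mixed (flatten _) _); apply: eq_map => j; rewrite ae0.
rewrite -hornerZ; apply: poly_limit0_le => e e_gt0; rewrite hornerZ qE.
have [||||||z z_gt0 Hz] := @mixed_capacity R I J (ae e) k (index_enum J) [::] [set: I].
- exact: index_enum_uniq.
- have /card_gt0P[j _] := J_gt0.
  by apply: contraTneq (mem_index_enum j) => ->.
- exact: k_gt0.
- by move=> j i; rewrite ffunE ltr_wpDl.
- by [].
- by rewrite addn0 szI cardsT.
(* With [#|I|] copies of one vector, the permanent is a factorial times the product of its
   coordinates, which [capP] bounds from below. *)
move: Hz; rewrite !cats0 {1}szI -cardsT mixed_nseq_card cardsT => Hz.
have zk_gt0 : 0 < \prod_j z j ^+ k j by apply: prodr_gt0 => j _; rewrite exprn_gt0.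
have kk_gt0 : 0 < \prod_j (k j)%:R ^+ k j :> R.
  by apply: prodr_gt0 => j _; rewrite exprn_gt0 // ltr0n.
have le1 : (#|I|)`!%:R * (cap * \prod_j z j ^+ k j) <=
           (#|I|)`!%:R * \prod_(i in [set: I]) wsum (index_enum J) z (ae e) i.
  rewrite ler_wpM2l ?ler0n //; apply: le_trans (capP z z_gt0) _.
  rewrite [leRHS](eq_bigl xpredT); last by move=> i; rewrite inE.
  apply: ler_prod => i _; rewrite ffunE; apply/andP; split.
    by apply: sumr_ge0 => j _; rewrite mulr_ge0 // ltW.
  by apply: ler_sum => j _; rewrite ler_pM2l // ffunE lerDl ltW.
have := le_trans le1 Hz; rewrite prodf_div szI -(ler_pM2r kk_gt0).
set K := \prod_j (k j)%:R ^+ k j in kk_gt0 *; set Z := \prod_j z j ^+ k j in zk_gt0 *.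
set M := mixed _ _ => le2; rewrite -(ler_pM2r zk_gt0).
have -> : cap * (#|I|)`!%:R * K * Z = (#|I|)`!%:R * (cap * Z) * K by ring.
suff -> : #|I|%:R ^+ #|I| * M * Z = Z / K * #|I|%:R ^+ #|I| * M * K by [].
by field; rewrite lt0r_neq0.
Qed.

(** * Zero-one matrices and the product of linear forms *)

Section ZeroOneMatrices.
Variables (m n : nat) (r : 'I_m -> nat) (c : 'I_n -> nat).

(** Exponents of the monomial: [inl i] stands for the variable [u_i], [inr j] for [y_j]. *)
Definition multiplicity (j : 'I_m + 'I_n) :=
  match j with inl i => (n - r i)%N | inr j => c j end.

(** Coefficients of one variable in the [mn] forms [u_i + y_j], which are indexed by the cells. *)
Definition incidence (R : comNzRingType) (j : 'I_m + 'I_n) : {ffun 'I_m * 'I_n -> R} :=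
  [ffun p => match j with inl i => (i == p.1)%:R | inr j => (j == p.2)%:R end].

Lemma sum_multiplicity : (forall i, r i <= n)%N -> (\sum_i r i)%N = (\sum_j c j)%N ->
  (\sum_j multiplicity j)%N = #|{: 'I_m * 'I_n}|.
Proof.
move=> r_le sum_rc; rewrite big_sumType /= -sum_rc -big_split /=.
rewrite (eq_bigr (fun=> n)) => [|i _]; last by rewrite subnK.
by rewrite sum_nat_const card_prod !card_ord.
Qed.

Lemma sum_incidence (R : comNzRingType) (z : 'I_m + 'I_n -> R) p :
  \sum_j z j * incidence R j p = z (inl p.1) + z (inr p.2).
Proof.
rewrite big_sumType /=; congr (_ + _).
  rewrite (bigD1 p.1) //= ffunE eqxx mulr1 big1 ?addr0 // => i /negPf ne.
  by rewrite ffunE ne mulr0.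
rewrite (bigD1 p.2) //= ffunE eqxx mulr1 big1 ?addr0 // => i /negPf ne.
by rewrite ffunE ne mulr0.
Qed.

(** In a nonzero term every cell picks its own row or its own column. Marking the cells that pick
    their column is injective and lands in [Sigma]. *)
Lemma mixed_incidence_le (R : numDomainType) (j0 : 'I_m + 'I_n) : (forall i, r i <= n)%N ->
  (\sum_i r i)%N = (\sum_j c j)%N ->
  mixed (flatten [seq nseq (multiplicity j) (incidence R j) | j <- index_enum _])
      [set: 'I_m * 'I_n]
    <= (\prod_j (multiplicity j)`!%:R) * #|Sigma r c|%:R.
Proof.
move=> r_le sum_rc.
rewrite (mixed_flatten j0) ?index_enum_uniq //; last by rewrite cardsT sum_multiplicity.
rewrite ler_wpM2l ?prodr_ge0 //.
pose ok := [pred phi : {ffun 'I_m * 'I_n -> 'I_m + 'I_n} |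
  fibered multiplicity j0 (index_enum _) [set: _] phi &&
  [forall p, (phi p == inl p.1) || (phi p == inr p.2)]].
pose mx (phi : {ffun 'I_m * 'I_n -> 'I_m + 'I_n}) : 'M[bool]_(m, n) :=
  \matrix_(i, j) (phi (i, j) == inr j).
have le_ok : \sum_(phi | fibered multiplicity j0 (index_enum _) [set: _] phi)
    \prod_(i in [set: 'I_m * 'I_n]) incidence R (phi i) i <= \sum_(phi | ok phi) 1.
  rewrite [leRHS]big_mkcondr; apply: ler_sum => phi _.
  case: ifP => [_|/negbT/forallPn[p]].
    apply: prodr_ile1 => p _; rewrite ffunE.
    by case: (phi p) => ?; case: (_ == _); rewrite /= ?lexx ?ler01.
  rewrite negb_or => /andP[h1 h2]; rewrite (bigD1 p) ?inE //= ffunE.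
  case: (phi p) h1 h2 => i.
    by rewrite (inj_eq inl_inj) => /negPf ->; rewrite mul0r.
  by rewrite (inj_eq inr_inj) => _ /negPf ->; rewrite mul0r.
apply: le_trans le_ok _; rewrite sumr_const ler_nat.
have okP phi : ok phi -> forall p, phi p = if mx phi p.1 p.2 then inr p.2 else inl p.1.
  move=> /andP[_ /forallP h] [i j]; rewrite mxE /=; have := h (i, j).
  by case: eqP => [->|_] //=; case: eqP.
rewrite -(card_in_imset (f := mx)); last first.
  move=> phi psi okphi okpsi e; apply/ffunP => p.
  by rewrite (okP _ okphi) (okP _ okpsi) e.
apply: subset_leq_card; apply/subsetP => _ /imsetP[phi okphi ->].
have /andP[/andP[_ /allP cnt] _] := okphi.
have fibE j : multiplicity j = (\sum_i \sum_l (phi (i, l) == j))%N.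
  have /eqP <- := cnt j (mem_index_enum _); rewrite -sum1dep_card big_mkcond /= pair_bigA.
  by apply: eq_bigr => p _; rewrite inE; case: p => i l /=; case: eqP.
have phiE i l : phi (i, l) = if mx phi i l then inr l else inl i by rewrite okP.
rewrite inE; apply/andP; split; apply/forallP.
  (* Every cell of row [i] is either marked or picks [inl i], and no cell of another row picks
     [inl i], so the marks and the [n - r i] picks add up to [n]. *)
  move=> i; rewrite -(eqn_add2r (multiplicity (inl i))) /= subnKC //; apply/eqP.
  rewrite -[(n - r i)%N]/(multiplicity (inl i)) fibE (bigD1 i) //=.
  rewrite [X in (_ + (_ + X))%N]big1 ?addn0 => [|i' /negPf ne]; last first.
    by apply: big1 => l _; rewrite phiE; case: ifP; rewrite // (inj_eq inl_inj) ne.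
  rewrite -big_split /= (eq_bigr (fun=> 1%N)) ?sum_nat_const ?card_ord ?muln1 // => l _.
  by rewrite phiE; case: (mx phi i l); rewrite //= eqxx.
move=> j; rewrite -[c j]/(multiplicity (inr j)) fibE; apply/eqP/eq_bigr => i _.
rewrite (bigD1 j) //= big1 ?addn0 => [|l /negPf ne].
  by rewrite phiE; case: (mx phi i j); rewrite //= eqxx.
by rewrite phiE; case: ifP; rewrite // (inj_eq inr_inj) ne.
Qed.

Lemma card_Sigma_le_F (R : realType) (x : 'I_m -> R) (y : 'I_n -> R) :
  (forall i, 0 < x i) -> (forall j, 0 < y j) -> #|Sigma r c|%:R <= F r c x y.
Proof.
move=> x_gt0 y_gt0.
have xr_gt0 : 0 < \prod_i x i ^+ r i by apply: prodr_gt0 => i _; rewrite exprn_gt0.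
have yc_gt0 : 0 < \prod_j y j ^+ c j by apply: prodr_gt0 => j _; rewrite exprn_gt0.
rewrite /F !prodfV -invfM [leRHS]mulrC ler_pdivlMr ?mulr_gt0 //.
pose w (D : 'M[bool]_(m, n)) := \prod_i \prod_j (x i * y j) ^+ D i j.
(* Each factor is a sum over a boolean exponent; distributing indexes the terms by boolean
   matrices. *)
have -> : \prod_i \prod_j (1 + x i * y j) = \sum_D w D.
  rewrite pair_bigA (eq_bigr (fun p => \sum_(b : bool) (x p.1 * y p.2) ^+ b)); last first.
    by move=> p _; rewrite big_bool /= expr1 expr0 addrC.
  rewrite bigA_distr_bigA /=.
  rewrite (reindex (fun D : 'M[bool]_(m, n) => [ffun p : 'I_m * 'I_n => D p.1 p.2])) /=.
    by apply: eq_bigr => D _; rewrite /w pair_bigA; apply: eq_bigr => p _; rewrite ffunE.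
  exists (fun f : {ffun 'I_m * 'I_n -> bool} => \matrix_(i, j) f (i, j)) => [D|f] _.
    by apply/matrixP => i j; rewrite mxE ffunE.
  by apply/ffunP => -[i j]; rewrite ffunE mxE.
rewrite (bigID (mem (Sigma r c))) /= -[leLHS]addr0; apply: lerD; last first.
  apply: sumr_ge0 => D _; apply: prodr_ge0 => i _; apply: prodr_ge0 => j _.
  by rewrite exprn_ge0 // mulr_ge0 // ltW.
(* A matrix of [Sigma] contributes exactly the monomial by which [F] divides. *)
rewrite [leRHS](eq_bigr (fun=> (\prod_i x i ^+ r i) * \prod_j y j ^+ c j)).
  by rewrite sumr_const -[X in _ <= X]mulr_natl.
move=> D; rewrite inE => /andP[/forallP Dr /forallP Dc].
rewrite /w; under eq_bigr do under eq_bigr do rewrite exprMn.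
under eq_bigr do rewrite big_split /=.
rewrite big_split /= [X in _ * X]exchange_big /=; congr (_ * _).
  by apply: eq_bigr => i _; rewrite prodrXr (eqP (Dr i)).
by apply: eq_bigr => j _; rewrite prodrXr (eqP (Dc j)).
Qed.

(* [F] in the variables [u_i = 1 / x_i] and [y_j] is the quotient of the product of the
   linear forms [u_i + y_j] by a monomial of the same degree. *)
Lemma F_homogeneous (R : realType) (z : 'I_m + 'I_n -> R) :
  (forall i, r i <= n)%N -> (forall j, 0 < z j) ->
  F r c (fun i => (z (inl i))^-1) (fun j => z (inr j)) * \prod_j z j ^+ multiplicity j =
  \prod_p \sum_j z j * incidence R j p.
Proof.
move=> r_le z_gt0.
under [RHS]eq_bigr do rewrite sum_incidence.
rewrite -(pair_bigA _ (fun i j => z (inl i) + z (inr j))) big_sumType /= /F.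
have z0 j : z j != 0 by rewrite lt0r_neq0.
rewrite (eq_bigr (fun i => z (inl i) ^+ r i)); last by move=> i _; rewrite exprVn invrK.
(* With [x_i = 1 / u_i], the factor [1 + x_i y_j] is [u_i^-1 (u_i + y_j)]; pulling out [u_i^-n] from
   row [i] turns [u_i^(r_i)] into [u_i^-(n - r_i)]. *)
under [X in _ * _ * X * _ = _]eq_bigr => i _.
  rewrite (eq_bigr (fun j => (z (inl i))^-1 * (z (inl i) + z (inr j)))); last first.
    by move=> j _; rewrite mulrDr mulVf.
  rewrite big_split /= prodr_const card_ord.
  over.
rewrite big_split /= prodfV.
have y0 : \prod_j z (inr j) ^+ c j != 0 by apply/prodf_neq0 => j _; rewrite expf_neq0.
have -> : \prod_i (z (inl i))^-1 ^+ n =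
    (\prod_i z (inl i) ^+ r i)^-1 * (\prod_i z (inl i) ^+ (n - r i))^-1.
  rewrite -!prodfV -big_split; apply: eq_bigr => i _ /=.
  by rewrite -invfM -exprD subnKC // exprVn.
have u1 : \prod_i z (inl i) ^+ r i != 0 by apply/prodf_neq0 => i _; rewrite expf_neq0.
have u2 : \prod_i z (inl i) ^+ (n - r i) != 0 by apply/prodf_neq0 => i _; rewrite expf_neq0.
by field; rewrite u1 u2 y0.
Qed.

End ZeroOneMatrices.

Theorem theorem1p1 (R : realType) (m n N : nat)
    (r : 'I_m -> nat) (c : 'I_n -> nat)
    (m_gt0 : (0 < m)%N) (n_gt0 : (0 < n)%N)
    (sum_r : (\sum_(i < m) r i)%N = N) (sum_c : (\sum_(j < n) c j)%N = N)
    (r_bound : forall i : 'I_m, (0 < r i < n)%N)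
    (c_bound : forall j : 'I_n, (0 < c j < m)%N) :
  (#|Sigma r c|%:R <= alpha R r c) /\
  ((m * n)`!%:R / (m * n)%:R ^+ (m * n) *
     (\prod_(i < m) ((n - r i)%:R ^+ (n - r i) / (n - r i)`!%:R)) *
     (\prod_(j < n) ((c j)%:R ^+ c j / (c j)`!%:R)) *
     alpha R r c
   <= #|Sigma r c|%:R :> R).
Proof.
have r_le i : (r i <= n)%N by have /andP[_ /ltnW] := r_bound i.
have sum_rc : (\sum_i r i)%N = (\sum_j c j)%N by rewrite sum_r sum_c.
split.
  apply: lb_le_inf.
    by exists (F r c (fun=> 1) (fun=> 1)); exists (fun=> 1), (fun=> 1).
  by move=> _ [x [y [x_gt0 y_gt0 ->]]]; apply: card_Sigma_le_F.
have multiplicity_gt0 j : (0 < multiplicity r c j)%N.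
  by case: j => [i|j] /=; [rewrite subn_gt0; case/andP: (r_bound i) | case/andP: (c_bound j)].
have cardI : #|{: 'I_m * 'I_n}| = (m * n)%N by rewrite card_prod !card_ord.
have cardJ : (0 < #|{: 'I_m + 'I_n}|)%N by rewrite card_sum !card_ord addn_gt0 m_gt0.
(* [alpha] serves as the constant [cap]: each [z] gives the point [x_i = 1 / z (inl i)],
   [y_j = z (inr j)] of the infimum. *)
have alphaP (z : 'I_m + 'I_n -> R) : (forall j, 0 < z j) ->
    alpha R r c * \prod_j z j ^+ multiplicity r c j <= \prod_p \sum_j z j * incidence R j p.
  move=> z_gt0; rewrite -(F_homogeneous c r_le z_gt0) ler_pM2r; last first.
    by apply: prodr_gt0 => j _; rewrite exprn_gt0.
  apply: ge_inf.
    exists #|Sigma r c|%:R => _ [x [y [x_gt0 y_gt0 ->]]].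
    exact: card_Sigma_le_F.
  by exists (fun i => (z (inl i))^-1), (fun j => z (inr j)); split => // i; rewrite invr_gt0.
have incidence_ge0 (j : 'I_m + 'I_n) p : 0 <= incidence R j p by rewrite ffunE; case: j.
have := capacity_bound cardJ multiplicity_gt0 incidence_ge0
          (sum_multiplicity r_le sum_rc) alphaP.
rewrite cardI => le_cap.
have D_gt0 : 0 < (m * n)%:R ^+ (m * n) :> R by rewrite exprn_gt0 // ltr0n muln_gt0 m_gt0.
have := mixed_incidence_le R (inl (Ordinal m_gt0)) r_le sum_rc.
rewrite -(ler_pM2l D_gt0) => /(le_trans le_cap).
rewrite !big_sumType /= !prodf_div.
set A := \prod_i (n - r i)%:R ^+ _; set B := \prod_i (n - r i)`!%:R.
set A' := \prod_j (c j)%:R ^+ _; set B' := \prod_j (c j)`!%:R.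
have B_gt0 : 0 < B by apply: prodr_gt0 => i _; rewrite ltr0n fact_gt0.
have B'_gt0 : 0 < B' by apply: prodr_gt0 => i _; rewrite ltr0n fact_gt0.
set D := (m * n)%:R ^+ _ in D_gt0 *; set f := (m * n)`!%:R.
move=> le_fin.
have -> : f / D * (A / B) * (A' / B') * alpha R r c =
   alpha R r c * f * (A * A') / (D * (B * B')).
  by field; rewrite !lt0r_neq0.
by rewrite ler_pdivrMr; [rewrite [leRHS]mulrC -[leRHS]mulrA | rewrite !mulr_gt0].
Qed.
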